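(* Let $\mathcal{R} = \langle \Sigma, \mathcal{I}, \mathcal{T}\rangle$ be a regular transition system. For every $b\geq 0$: (1) $\mathit{IndInv}_b$ is an inductive invariant, and $\mathit{IndInv}_b \subseteq S$ for every inductive $b$-invariant $S$. (2) $\mathit{IndInv}_b \supseteq \mathit{IndInv}_{b+1}$. (3) $\mathit{Reach} = \bigcap_{b=0}^\infty \mathit{IndInv}_b$.
   Context: All alphabets are finite. For words $w, u \in \Sigma^*$ of the same length $\ell$, $\langle w,u\rangle$ denotes the word $\langle w[1],u[1]\rangle \cdots \langle w[\ell],u[\ell]\rangle \in (\Sigma\times\Sigma)^*$. A (length-preserving) transducer over $\Sigma\times\Sigma$ is an NFA over the alphabet $\Sigma \times \Sigma$. A regular transition system (RTS) is a triple $\langle \Sigma, \mathcal{I}, \mathcal{T}\rangle$ with $\Sigma$ an alphabet, $\mathcal{I}$ an NFA over $\Sigma$, and $\mathcal{T}$ a transducer over $\Sigma\times\Sigma$. Words over $\Sigma$ are configurations; those accepted by $\mathcal{I}$ are initial; $w \leadsto u$ means that $|w|=|u|$ and $\langle w,u\rangle$ is accepted by $\mathcal{T}$; $\mathit{Reach}$ is the set of configurations reachable from some initial configuration via the reflexive-transitive closure of $\leadsto$. A set $S\subseteq\Sigma^*$ is inductive if $w\in S$ and $w\leadsto u$ imply $u\in S$; it is an invariant if $\mathit{Reach}\subseteq S$; it is an inductive invariant if it is both. For $\ell\ge 0$, $\mathit{AP}_\ell$ is the set of atomic propositions $q_{j:\ell}$ with $q\in\Sigma$, $j\in[1,\ell]$.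 A formula over $\mathit{AP}_\ell$ is a positive Boolean formula in conjunctive normal form over $\mathit{AP}_\ell$ and the constants $\mathit{true}$, $\mathit{false}$ (an empty clause is $\mathit{false}$). A configuration of length $\ell$ satisfies $q_{j:\ell}$ iff its $j$-th letter is $q$, with the usual extension to Boolean combinations; every configuration of length different from $\ell$ satisfies every formula over $\mathit{AP}_\ell$. $L(\varphi)$ is the set of configurations satisfying $\varphi$, and $\varphi$ is inductive if $L(\varphi)$ is inductive. A $b$-formula is a formula with at most $b$ clauses ($\mathit{true}$ being the only formula with $0$ clauses). A set $S\subseteq\Sigma^*$ is $b$-bounded if for every $\ell$ there is a $b$-formula $\varphi_\ell$ over $\mathit{AP}_\ell$ with $S\cap\Sigma^\ell = L(\varphi_\ell)\cap\Sigma^\ell$; a $b$-invariant is a $b$-bounded invariant, and an inductive $b$-invariant is a $b$-bounded inductive invariant. For configurations $u,w$, write $u \stackrel{*}{\leadsto}_b w$ if every inductive $b$-formula (over any $\mathit{AP}_\ell$) satisfied by $u$ is also satisfied by $w$. Let $\mathit{IndInv}_b = \{w\in\Sigma^*\mid u \stackrel{*}{\leadsto}_b w \text{ for some initial configuration } u\}$. *)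

(* Defs.v *)
From Stdlib Require Import Relation_Operators.
From mathcomp Require Import all_boot.
From mathcomp Require Import boolp classical_sets.

Set Implicit Arguments.
Unset Strict Implicit.
Unset Printing Implicit Defensive.

Local Open Scope classical_set_scope.

Record nfa (Sigma : finType) := Nfa {
  nfa_state : finType;
  nfa_start : {set nfa_state};
  nfa_step : nfa_state -> Sigma -> {set nfa_state};
  nfa_final : {set nfa_state}
}.

Fixpoint nfa_accept_from (Sigma : finType) (A : nfa Sigma)
    (q : nfa_state A) (w : seq Sigma) : bool :=
  if w is a :: w' then
    [exists q' in nfa_step q a, nfa_accept_from q' w']
  else q \in nfa_final A.

Definition nfa_accepts (Sigma : finType) (A : nfa Sigma) (w : seq Sigma) : bool :=
  [exists q in nfa_start A, nfa_accept_from q w].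

Definition transducer (Sigma : finType) := nfa (Sigma * Sigma)%type.

Record rts (Sigma : finType) := Rts {
  rts_init : nfa Sigma;
  rts_trans : transducer Sigma
}.

Section Configurations.

Context (Sigma : finType) (RTS : rts Sigma).

Definition initial : set (seq Sigma) := [set w | nfa_accepts (rts_init RTS) w].

(* [zip] truncates to the shorter word, hence the explicit length condition. *)
Definition leads_to (w u : seq Sigma) : Prop :=
  size w = size u /\ nfa_accepts (rts_trans RTS) (zip w u).

Definition Reach : set (seq Sigma) :=
  [set w | exists2 u, initial u & clos_refl_trans (seq Sigma) leads_to u w].

Definition inductive_set (S : set (seq Sigma)) : Prop :=
  forall w u, S w -> leads_to w u -> S u.

Definition invariant (S : set (seq Sigma)) : Prop := Reach `<=` S.

Definition inductive_invariant (S : set (seq Sigma)) : Prop :=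
  inductive_set S /\ invariant S.

End Configurations.

(* [Atom q j] is the proposition $q_{j+1:l}$: positions are counted from 0. *)
Inductive literal (Sigma : finType) (l : nat) :=
  | Const of bool
  | Atom of Sigma & 'I_l.

(* A clause is the disjunction of its literals and a formula is the conjunction
   of its clauses, so [[::]] is false as a clause and true as a formula. *)
Definition clause (Sigma : finType) (l : nat) := seq (literal Sigma l).
Definition formula (Sigma : finType) (l : nat) := seq (clause Sigma l).

Definition sat_literal (Sigma : finType) (l : nat) (w : seq Sigma)
    (x : literal Sigma l) : bool :=
  match x with
  | Const c => c
  | Atom q j => onth w j == Some q
  end.

Definition sat (Sigma : finType) (l : nat) (w : seq Sigma)
    (phi : formula Sigma l) : bool :=
  (size w == l) ==> all (has (sat_literal w)) phi.

Definition lang (Sigma : finType) (l : nat) (phi : formula Sigma l) :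
    set (seq Sigma) := [set w | sat w phi].

Definition b_formula (Sigma : finType) (b l : nat) (phi : formula Sigma l) : Prop :=
  size phi <= b.

Definition words (Sigma : finType) (l : nat) : set (seq Sigma) :=
  [set w | size w = l].

Definition b_bounded (Sigma : finType) (b : nat) (S : set (seq Sigma)) : Prop :=
  forall l, exists2 phi : formula Sigma l,
    b_formula b phi & S `&` words l = lang phi `&` words l.

Section InductiveInvariants.

Context (Sigma : finType) (RTS : rts Sigma).

Definition inductive_formula (l : nat) (phi : formula Sigma l) : Prop :=
  inductive_set RTS (lang phi).

Definition inductive_b_invariant (b : nat) (S : set (seq Sigma)) : Prop :=
  b_bounded b S /\ inductive_invariant RTS S.

Definition b_leads_to (b : nat) (u w : seq Sigma) : Prop :=
  forall (l : nat) (phi : formula Sigma l),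
    b_formula b phi -> inductive_formula phi -> sat u phi -> sat w phi.

Definition IndInv (b : nat) : set (seq Sigma) :=
  [set w | exists2 u, initial RTS u & b_leads_to b u w].

End InductiveInvariants.

(* Main.v *)
(* A formula that agrees on length l with an inductive set S is itself
   inductive, since transitions preserve the length; hence IndInv_b is contained
   in every inductive invariant at the lengths where it is given by a b-formula.
   For (3), Reach restricted to length l is a finite set, so it is defined by the
   formula with one clause for each excluded word. *)

Require Import Defs.
From Stdlib Require Import Relation_Operators.
From mathcomp Require Import all_boot.
From mathcomp Require Import boolp classical_sets.

Local Open Scope classical_set_scope.

Lemma sat_words (Sigma : finType) (l : nat) (S : set (seq Sigma))
    (phi : formula Sigma l) (w : seq Sigma) :
  S `&` words l = lang phi `&` words l -> size w = l ->
  S w <-> sat w phi.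
Proof.
move=> eqS szw; have := congr1 (fun X => X w) eqS => /= eqw.
split=> [Sw|satw].
- by have [] : (lang phi `&` words l) w by rewrite -eqS.
- by have [] : (S `&` words l) w by rewrite eqS.
Qed.

Lemma sat_size_neq (Sigma : finType) (l : nat) (phi : formula Sigma l)
    (w : seq Sigma) : size w <> l -> sat w phi.
Proof. by move=> /eqP neq; rewrite /sat (negbTE neq). Qed.

Lemma inductive_formula_words (Sigma : finType) (RTS : rts Sigma) (l : nat)
    (S : set (seq Sigma)) (phi : formula Sigma l) :
  inductive_set RTS S ->
  S `&` words l = lang phi `&` words l ->
  inductive_formula RTS phi.
Proof.
move=> indS eqS x y satx xy; have [szxy _] := xy.
(* Words of length other than [l] satisfy [phi] vacuously, so only transitions inside length [l]
   matter. *)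
case: (pselect (size y = l)) => [szy|]; last exact: sat_size_neq.
have szx : size x = l by rewrite szxy.
apply/(sat_words _ _ _ _ _ eqS szy); apply: indS xy.
exact/(sat_words _ _ _ _ _ eqS szx).
Qed.

Lemma Reach_initial (Sigma : finType) (RTS : rts Sigma) :
  initial RTS `<=` Reach RTS.
Proof. by move=> u Iu; exists u => //; apply: rt_refl. Qed.

Lemma inductive_Reach (Sigma : finType) (RTS : rts Sigma) :
  inductive_set RTS (Reach RTS).
Proof.
move=> w v [u Iu uw] wv; exists u => //.
by apply: rt_trans uw _; apply: rt_step.
Qed.

Lemma Reach_sub_inductive (Sigma : finType) (RTS : rts Sigma)
    (S : set (seq Sigma)) :
  inductive_set RTS S -> initial RTS `<=` S -> Reach RTS `<=` S.
Proof.
move=> indS subS w [u /subS Su uw].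
elim: uw Su => // [x y xy Sx|x y z _ IHxy _ IHyz /IHxy /IHyz //].
exact: indS xy.
Qed.

(** Working at a single length [l] lets the bound vary with the length, as (3) requires. *)
Lemma IndInv_sub_words (Sigma : finType) (RTS : rts Sigma) (b l : nat)
    (S : set (seq Sigma)) (phi : formula Sigma l) :
  inductive_invariant RTS S -> b_formula b phi ->
  S `&` words l = lang phi `&` words l ->
  IndInv RTS b `&` words l `<=` S.
Proof.
move=> [indS invS] bphi eqS w [[u Iu uw] szw].
apply/(sat_words _ _ _ _ _ eqS szw); apply: uw => //.
  exact: inductive_formula_words indS eqS.
(* The initial word [u] need not have length [l]; if it does not, it satisfies [phi] vacuously. *)
case: (pselect (size u = l)) => [szu|]; last exact: sat_size_neq.
by apply/(sat_words _ _ _ _ _ eqS szu)/invS/Reach_initial.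
Qed.

(** Formulas are positive, so differing from [v] at a position is written as carrying one of the
    other letters there. For [l = 0] the clause is empty, hence false, and excludes the only
    word. *)
Definition avoiding_clause (Sigma : finType) (l : nat) (v : l.-tuple Sigma) :
    clause Sigma l :=
  [seq Atom p.1 p.2 | p <- enum {: Sigma * 'I_l} & p.1 != tnth v p.2].

Lemma sat_avoiding_clause (Sigma : finType) (l : nat) (v w : l.-tuple Sigma) :
  has (sat_literal w) (avoiding_clause Sigma l v) = (w != v).
Proof.
have onthE (j : 'I_l) : onth w j = Some (tnth w j).
  by rewrite onthE (nth_map (tnth w j)) ?size_tuple // -tnth_nth.
rewrite /avoiding_clause has_map.
apply/hasP/idP => [[[q j]]|neq].
- rewrite mem_filter /= => /andP[neq _]; rewrite onthE => /eqP[eqq].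
  by apply: contraNneq neq => <-; rewrite eqq.
- have [j neqj] : exists j, tnth w j != tnth v j.
    apply/existsP; rewrite -negb_forall; apply: contraNN neq => /forallP eqwv.
    by apply/eqP/eq_from_tnth => j; apply/eqP.
  exists (tnth w j, j); last by rewrite /= onthE.
  by rewrite mem_filter mem_enum andbT.
Qed.

Lemma exists_formula_words (Sigma : finType) (l : nat) (S : set (seq Sigma)) :
  exists phi : formula Sigma l,
    S `&` words l = lang phi `&` words l.
Proof.
exists [seq avoiding_clause Sigma l v
       | v : l.-tuple Sigma <- enum {: l.-tuple Sigma} & ~~ `[< S v >]].
apply/seteqP; split=> w [/= Sw szw]; split=> //.
- rewrite /lang /sat /=; apply/implyP => {}szw.
  rewrite all_map; apply/allP => v; rewrite mem_filter => /andP[nSv _] /=.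
  have := sat_avoiding_clause Sigma l v (Tuple szw).
  move=> /= ->; apply: contraNneq nSv => <-; exact/asboolP.
- move: Sw; rewrite /lang /= /sat szw eqxx /= all_map => /allP satw.
  apply: contrapT => nSw; move/eqP: szw => szw.
  (* Were [w] outside [S], its own avoiding clause would belong to the formula, and [w] falsifies
     it. *)
  have /satw /= : Tuple szw \in
      [seq v : l.-tuple Sigma <- enum {: l.-tuple Sigma} | ~~ `[< S v >]].
    by rewrite mem_filter mem_enum andbT; apply/asboolPn.
  have := sat_avoiding_clause Sigma l (Tuple szw) (Tuple szw).
  by move=> /= ->; rewrite eqxx.
Qed.

(** The initial word that witnesses [w] also witnesses its successors, since inductive formulas
    survive a transition. Initial words witness themselves. *)
Lemma inductive_invariant_IndInv (Sigma : finType) (RTS : rts Sigma) (b : nat) :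
  inductive_invariant RTS (IndInv RTS b).
Proof.
have ind : inductive_set RTS (IndInv RTS b).
  move=> w v [u Iu uw] wv; exists u => // l phi bphi indphi satu.
  by apply: (indphi w) wv; apply: uw.
by split=> //; apply: Reach_sub_inductive => // u Iu; exists u.
Qed.

Theorem proposition3p6 (Sigma : finType) (RTS : rts Sigma) (b : nat) :
  [/\ inductive_invariant RTS (IndInv RTS b) /\
      (forall S : set (seq Sigma),
         inductive_b_invariant RTS b S -> IndInv RTS b `<=` S),
      IndInv RTS b.+1 `<=` IndInv RTS b &
      Reach RTS = \bigcap_(c : nat) IndInv RTS c].
Proof.
split.
- split=> [|S [bS indinvS] w IIw]; first exact: inductive_invariant_IndInv.
  (* The length of [w], not of the initial word: [b_leads_to] with [b = 0] may
     relate words of different lengths. *)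
  have [phi bphi eqS] := bS (size w).
  exact: IndInv_sub_words indinvS bphi eqS w (conj IIw erefl).
(* The same [u] works: a larger bound only adds formulas to be preserved. *)
- move=> w [u Iu uw]; exists u => // l phi bphi; apply: uw.
  exact: leq_trans bphi (leqnSn b).
- apply/seteqP; split=> [w Rw c _|w IIw].
    by have [_] := inductive_invariant_IndInv Sigma RTS c; apply.
  have [phi eqR] := exists_formula_words Sigma (size w) (Reach RTS).
  have indinvR : inductive_invariant RTS (Reach RTS).
    by split=> //; apply: inductive_Reach.
  (* The bound is the number of clauses of the formula for the length of [w]; the intersection
     supplies membership at every bound. *)
  apply: (IndInv_sub_words _ _ (size phi) _ _ _ indinvR (leqnn _) eqR w).
  by split=> //; apply: IIw.
Qed.
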